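(* Let $(A,m,\sigma)$ be a braided algebra over $\mathbb{K}$ and $\lambda\in\mathbb{K}$, and let $\mathcal{R}_{\sigma,\lambda}(A)=(A\underline{\otimes}T(A),\lozenge_{\sigma,\lambda})$. With respect to the vector space decomposition $\mathcal{R}_{\sigma,\lambda}(A)=(A\underline{\otimes}\mathbb{K})\oplus\big(\bigoplus_{i\ge1}A\underline{\otimes}A^{\otimes i}\big)$, the projection $P_1$ from $\mathcal{R}_{\sigma,\lambda}(A)$ onto its subalgebra $A=A\underline{\otimes}\mathbb{K}$ is an idempotent Rota-Baxter operator of weight $-1$. So is the projection $P_2$ from $\mathcal{R}_{\sigma,\lambda}(A)$ onto its subalgebra $\bigoplus_{i\ge1}A\underline{\otimes}A^{\otimes i}$.
   Context: $\mathbb{K}$ is a field of characteristic 0; all vector spaces and algebras are over $\mathbb{K}$; algebras are associative but not necessarily unital. $T(V)=\bigoplus_{i\ge 0}V^{\otimes i}$ is the tensor algebra (as a vector space); $\otimes$ is the tensor product inside $T(V)$, and $\underline{\otimes}$ is the tensor product between $T(V)$ (or subspaces of it) and $T(V)$. Rota-Baxter operator: for $\lambda\in\mathbb{K}$, a linear endomorphism $P$ of an algebra $R$ is a Rota-Baxter operator of weight $\lambda$ if $P(x)P(y)=P(xP(y))+P(P(x)y)+\lambda P(xy)$ for all $x,y\in R$. It is idempotent if $P\circ P=P$. Braiding: an invertible linear map $\sigma\in\mathrm{End}(V\otimes V)$ with $(\sigma\otimes\mathrm{id}_V)(\mathrm{id}_V\otimes\sigma)(\sigma\otimes\mathrm{id}_V)=(\mathrm{id}_V\otimes\sigma)(\sigma\otimes\mathrm{id}_V)(\mathrm{id}_V\otimes\sigma)$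 on $V^{\otimes 3}$. Write $\sigma_i=\mathrm{id}_V^{\otimes i-1}\otimes\sigma\otimes\mathrm{id}_V^{\otimes n-i-1}$ on $V^{\otimes n}$. For $w\in\mathfrak{S}_n$ with reduced expression $w=s_{i_1}\cdots s_{i_l}$ ($s_i$ the transposition of $i,i+1$), put $T^\sigma_w=\sigma_{i_1}\cdots\sigma_{i_l}$ (well defined). The map $\beta:T(V)\underline{\otimes}T(V)\to T(V)\underline{\otimes}T(V)$ has restriction $\beta_{ij}=\beta_{i,j}=T^\sigma_{\chi_{ij}}$ to $V^{\otimes i}\underline{\otimes}V^{\otimes j}$ for $i,j\ge1$, where $\chi_{ij}\in\mathfrak{S}_{i+j}$ sends $k\mapsto j+k$ for $1\le k\le i$ and $i+k\mapsto k$ for $1\le k\le j$ (so $\beta_{ij}$ maps $V^{\otimes i}\underline{\otimes}V^{\otimes j}$ to $V^{\otimes j}\underline{\otimes}V^{\otimes i}$, $\beta_{11}=\sigma$); $\beta_{0i},\beta_{i0}$ are the identity of $V^{\otimes i}$. Braided algebra: a triple $(A,m,\sigma)$ with $(A,m)$ an algebra and $\sigma$ a braiding on $A$ such that $(\mathrm{id}_A\otimes m)\sigma_1\sigma_2=\sigma(m\otimes\mathrm{id}_A)$ and $(m\otimes\mathrm{id}_A)\sigma_2\sigma_1=\sigma(\mathrm{id}_A\otimes m)$. Quantum quasi-shuffle product of a braided algebra $(A,m,\sigma)$: the map $\Join_\sigma:T(A)\underline{\otimes}T(A)\to T(A)$ with $\mu\Join_\sigma x=x\Join_\sigma\mu=\mu\cdot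 x$ for $\mu\in\mathbb{K}$, $x\in T(A)$, and recursively for $a_k,b_k\in A$, $i,j\ge 1$ (writing $\Join_{\sigma(i,j)}$ for the restriction to $A^{\otimes i}\underline{\otimes}A^{\otimes j}$): $(a_1\otimes\cdots\otimes a_i)\Join_\sigma(b_1\otimes\cdots\otimes b_j)=a_1\otimes\big((a_2\otimes\cdots\otimes a_i)\Join_\sigma(b_1\otimes\cdots\otimes b_j)\big)+(\mathrm{id}_A\otimes\Join_{\sigma(i,j-1)})(\beta_{i,1}\otimes\mathrm{id}_A^{\otimes j-1})(a_1\otimes\cdots\otimes a_i\otimes b_1\otimes\cdots\otimes b_j)+(m\otimes\Join_{\sigma(i-1,j-1)})(\mathrm{id}_A\otimes\beta_{i-1,1}\otimes\mathrm{id}_A^{\otimes j-1})(a_1\otimes\cdots\otimes a_i\otimes b_1\otimes\cdots\otimes b_j)$, where empty tensors are interpreted as $1\in\mathbb{K}$ (e.g. $a_1\Join_\sigma b_1=a_1\otimes b_1+\sigma(a_1\otimes b_1)+m(a_1\otimes b_1)$). It is known that $(T(A),\Join_\sigma)$ is an associative algebra with unit $1\in\mathbb{K}$. For $\lambda\in\mathbb{K}$, $(A,\lambda\cdot m,\sigma)$ is again a braided algebra; $\Join_{\sigma,\lambda}$ denotes its quantum quasi-shuffle product. $\mathcal{R}_{\sigma,\lambda}(A)$ is the space $A\underline{\otimes}T(A)$ with the associative product $\lozenge_{\sigma,\lambda}=(m\otimes\Join_{\sigma,\lambda})(\mathrm{id}_A\otimes\beta\otimes\mathrm{id}_{T(A)})$,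 where $\beta$ is applied to the middle factors $T(A)\underline{\otimes}A$. *)

(* Defs.v *)
From HB Require Import structures.
From mathcomp Require Import all_boot all_order all_algebra all_fingroup.
From mathcomp Require Import generic_quotient ring_quotient.
From mathcomp Require Import freeg.
From mathcomp Require Import boolp.

Set Implicit Arguments.
Unset Strict Implicit.
Unset Printing Implicit Defensive.

Import GRing.Theory.
Local Open Scope ring_scope.
Local Open Scope quotient_scope.

Section LinearExtension.
Variables (K : fieldType) (T : choiceType) (W : lmodType K) (f : T -> W).

Lemma fglift_linear : linear (fglift f : {freeg T / K} -> W).
Proof.
have B (x y : {freeg T / K}) : fglift f (x - y) = fglift f x - fglift f y.
  exact: lift_is_additive.
have f0 : fglift f (0 : {freeg T / K}) = 0 by rewrite -(subrr 0) B subrr.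
have addf (x y : {freeg T / K}) : fglift f (x + y) = fglift f x + fglift f y.
  by rewrite -{1}[y]opprK B -[- y]sub0r B f0 sub0r opprK.
move=> c x y; rewrite addf; congr (_ + _).
have sumf (I : Type) (s : seq I) (F : I -> {freeg T / K}) :
    fglift f (\sum_(i <- s) F i) = \sum_(i <- s) fglift f (F i).
  elim: s => [|i s IH]; last by rewrite !big_cons addf IH.
  by rewrite !big_nil f0.
rewrite {1}/GRing.scale /= /fgscale -{3}[x]freeg_sumE !sumf scaler_sumr.
by apply: eq_bigr => t _; rewrite !liftU scalerA.
Qed.

End LinearExtension.

Section TensorProduct.
Variables (K : fieldType) (U V : lmodType K).

Let pure (u : U) (v : V) : {freeg (U * V) / K} := << (u, v) >>.

(* The subspace of the free space on U * V spanned by the bilinearity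
   relations; the tensor product is the quotient by it. *)
Inductive tensor_rel : {freeg (U * V) / K} -> Prop :=
| tensor_rel0 : tensor_rel 0
| tensor_relD x y : tensor_rel x -> tensor_rel y -> tensor_rel (x + y)
| tensor_relZ c x : tensor_rel x -> tensor_rel (c *: x)
| tensor_relDl u u' v : tensor_rel (pure (u + u') v - pure u v - pure u' v)
| tensor_relDr u v v' : tensor_rel (pure u (v + v') - pure u v - pure u v')
| tensor_relZl c u v : tensor_rel (pure (c *: u) v - c *: pure u v)
| tensor_relZr c u v : tensor_rel (pure u (c *: v) - c *: pure u v).

Definition tensor_ker : {pred {freeg (U * V) / K}} :=
  fun x => `[< tensor_rel x >].

Lemma tensor_ker_zmod : zmod_closed tensor_ker.
Proof.
split=> [|x y /asboolP hx /asboolP hy]; apply/asboolP; first exact: tensor_rel0.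
by apply: tensor_relD => //; rewrite -scaleN1r; apply: tensor_relZ.
Qed.

HB.instance Definition _ := GRing.isZmodClosed.Build _ tensor_ker tensor_ker_zmod.

Definition tensor := Quotient.quot tensor_ker.

HB.instance Definition _ := GRing.Zmodule.on tensor.
HB.instance Definition _ := EqQuotient.on tensor.

Lemma tensor_eqP (x y : {freeg (U * V) / K}) :
  \pi_tensor x = \pi_tensor y <-> tensor_rel (x - y).
Proof.
split=> [/eqP|h].
  by rewrite -Quotient.idealrBE => /asboolP.
by apply/eqP; rewrite -Quotient.idealrBE; apply/asboolP.
Qed.

Lemma tensor_piD (x y : {freeg (U * V) / K}) :
  \pi_tensor (x + y) = \pi_tensor x + \pi_tensor y.
Proof. exact: pi_addr. Qed.

Definition tensor_scale (c : K) (x : tensor) : tensor := \pi_tensor (c *: repr x).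

Lemma tensor_piZ c (x : {freeg (U * V) / K}) :
  \pi_tensor (c *: x) = tensor_scale c (\pi_tensor x).
Proof.
apply/tensor_eqP; rewrite -scalerBr; apply: tensor_relZ.
by apply/tensor_eqP; rewrite reprK.
Qed.

Lemma tensor_scaleA a b x :
  tensor_scale a (tensor_scale b x) = tensor_scale (a * b) x.
Proof.
by elim/quotW: x => x; rewrite -(tensor_piZ b x) -!tensor_piZ scalerA.
Qed.

Lemma tensor_scale1 : left_id 1 tensor_scale.
Proof. by elim/quotW => x; rewrite -tensor_piZ scale1r. Qed.

Lemma tensor_scaleDr : right_distributive tensor_scale +%R.
Proof.
move=> c; elim/quotW => x; elim/quotW => y.
by rewrite -tensor_piD -!tensor_piZ scalerDr tensor_piD.
Qed.

Lemma tensor_scaleDl x : {morph tensor_scale^~ x : a b / a + b}.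
Proof.
by elim/quotW: x => x a b; rewrite -!tensor_piZ scalerDl tensor_piD.
Qed.

HB.instance Definition _ := GRing.Zmodule_isLmodule.Build K tensor
  tensor_scaleA tensor_scale1 tensor_scaleDr tensor_scaleDl.

Let split_rel (p q r s : {freeg (U * V) / K}) :
  p - (q + s) = (p - r - s) + (r - q).
Proof. by rewrite (addrAC p) addrA subrK opprD addrA addrAC. Qed.

Definition tmul (u : U) (v : V) : tensor := \pi_tensor (pure u v).

Lemma tmul_linearr u : linear (tmul u).
Proof.
move=> c v v'.
have -> : c *: tmul u v = \pi_tensor (c *: pure u v) by rewrite tensor_piZ.
rewrite -tensor_piD; apply/tensor_eqP.
rewrite (split_rel _ _ (pure u (c *: v))).
by apply: tensor_relD; [exact: tensor_relDr|exact: tensor_relZr].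
Qed.

Lemma tmul_linearl v : linear (tmul^~ v).
Proof.
move=> c u u' /=.
have -> : c *: tmul u v = \pi_tensor (c *: pure u v) by rewrite tensor_piZ.
rewrite -tensor_piD; apply/tensor_eqP.
rewrite (split_rel _ _ (pure (c *: u) v)).
by apply: tensor_relD; [exact: tensor_relDl|exact: tensor_relZl].
Qed.

HB.instance Definition _ u :=
  GRing.isLinear.Build K V tensor *:%R (tmul u) (tmul_linearr u).

Lemma tensor_ind (P : tensor -> Prop) :
  P 0 -> (forall x y, P x -> P y -> P (x + y)) -> (forall u v, P (tmul u v)) ->
  forall x, P x.
Proof.
move=> P0 PD Pm x; rewrite -[x]reprK -[repr x]freeg_sumE.
elim: dom => [|[u v] s IH].
  by rewrite big_nil -[0]subr0 -[\pi _]addr0 pi_addr pi_oppr subrr addr0.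
rewrite big_cons tensor_piD; apply: PD => //.
have -> : << coeff (u, v) (repr x) *g (u, v) >> =
          coeff (u, v) (repr x) *: pure u v.
  apply/eqP/freeg_eqP => z; rewrite coeffZ !coeffU.
  by rewrite mul1r.
rewrite tensor_piZ.
have -> : tensor_scale (coeff (u, v) (repr x)) (\pi_tensor (pure u v)) =
          tmul u (coeff (u, v) (repr x) *: v) by rewrite linearZ.
exact: Pm.
Qed.

End TensorProduct.

Arguments tensor {K} U V.
Arguments tmul {K U V} u v.
Arguments tmul_linearl {K U V} v.
Arguments tmul_linearr {K U V} u.

Notation "U ⊗ V" := (tensor U V) (at level 40, left associativity) : type_scope.
Notation "u \ot v" := (tmul u v) (at level 40, left associativity) : ring_scope.
Section TensorMaps.
Variable K : fieldType.
Implicit Types U V W : lmodType K.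

Section Lift.
Variables (U V W : lmodType K) (f : U -> V -> W).
Hypotheses (fl : forall v, linear (f^~ v)) (fr : forall u, linear (f u)).

Definition tlift_fun (x : U ⊗ V) : W := fglift (fun p => f p.1 p.2) (repr x).

Lemma tlift_fun_pi (x : {freeg (U * V) / K}) :
  tlift_fun (\pi_(U ⊗ V) x) = fglift (fun p => f p.1 p.2) x.
Proof.
pose L := GRing.isLinear.Build K _ _ _ _ (fglift_linear (fun p : U * V => f p.1 p.2)).
pose g : {linear {freeg (U * V) / K} -> W} :=
  HB.pack (fglift (fun p : U * V => f p.1 p.2)) L.
have Df v u u' : f (u + u') v = f u v + f u' v.
  by have := fl v 1 u u'; rewrite /= !scale1r.
have Dr u v v' : f u (v + v') = f u v + f u v'.
  by have := fr u 1 v v'; rewrite /= !scale1r.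
have f0l v : f 0 v = 0 by apply: (addrI (f 0 v)); rewrite -Df !addr0.
have f0r u : f u 0 = 0 by apply: (addrI (f u 0)); rewrite -Dr !addr0.
have E u v : g << (u, v) >> = f u v by rewrite /= liftU scale1r.
have ker y : tensor_rel y -> g y = 0.
  elim=> [|y1 y2 _ h1 _ h2|c y1 _ h|u u' v|u v v'|c u v|c u v].
  - exact: linear0.
  - by rewrite linearD h1 h2 addr0.
  - by rewrite linearZ_LR h scaler0.
  - by rewrite !linearB !E Df addrAC addrK subrr.
  - by rewrite !linearB !E Dr addrAC addrK subrr.
  - rewrite linearB linearZ_LR !E.
    by have := fl v c u 0; rewrite /= f0l !addr0 => ->; rewrite subrr.
  - rewrite linearB linearZ_LR !E.
    by have := fr u c v 0; rewrite /= f0r !addr0 => ->; rewrite subrr.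
apply/eqP; rewrite -subr_eq0 -[_ - _](linearB g); apply/eqP/ker.
by apply/tensor_eqP; rewrite reprK.
Qed.

Lemma tlift_fun_linear : linear tlift_fun.
Proof.
move=> c x y; elim/quotW: x => x; elim/quotW: y => y.
have -> : c *: \pi_(U ⊗ V) x = \pi_(U ⊗ V) (c *: x) by rewrite tensor_piZ.
by rewrite -tensor_piD !tlift_fun_pi fglift_linear.
Qed.

HB.instance Definition _ :=
  GRing.isLinear.Build K (U ⊗ V) W *:%R tlift_fun tlift_fun_linear.

Definition tlift : {linear U ⊗ V -> W} := tlift_fun.

Lemma tliftE u v : tlift (u \ot v) = f u v.
Proof. by rewrite /= tlift_fun_pi liftU scale1r. Qed.

End Lift.

Lemma tensor_ext U V W (f g : {linear U ⊗ V -> W}) :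
  (forall u v, f (u \ot v) = g (u \ot v)) -> f =1 g.
Proof.
move=> h; elim/tensor_ind => [|x y hx hy|//]; first by rewrite !linear0.
by rewrite !linearD hx hy.
Qed.

Definition tmull U V (v : V) : U -> U ⊗ V := tmul^~ v.
HB.instance Definition _ U V (v : V) :=
  GRing.isLinear.Build K U (U ⊗ V) *:%R (@tmull U V v) (tmul_linearl v).

Section Map.
Variables (U V U' V' : lmodType K) (f : {linear U -> U'}) (g : {linear V -> V'}).
Let tmap_l v : linear (fun u => f u \ot g v).
Proof. by move=> c u u'; rewrite linearP tmul_linearl. Qed.
Let tmap_r u : linear (fun v => f u \ot g v).
Proof. by move=> c v v'; rewrite linearP tmul_linearr. Qed.
Definition tmap : {linear U ⊗ V -> U' ⊗ V'} := tlift tmap_l tmap_r.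
Lemma tmapE u v : tmap (u \ot v) = f u \ot g v.
Proof. exact: tliftE. Qed.
End Map.

Section Assoc.
Variables U V W : lmodType K.

Definition tassoc_w (w : W) : {linear U ⊗ V -> U ⊗ (V ⊗ W)} := tmap idfun (tmull w).
Let tassoc_l w : linear (tassoc_w w). Proof. exact: linearP. Qed.
Let tassoc_r x : linear (tassoc_w^~ x).
Proof.
move=> c w w'.
rewrite -[LHS]/(tassoc_w (c *: w + w') x) -[RHS]/(c *: tassoc_w w x + tassoc_w w' x).
elim/tensor_ind: x => [|x y hx hy|u v].
- by rewrite !linear0 addr0.
- by rewrite !linearD hx hy addrACA.
- by rewrite !tmapE /= /tmull tmul_linearr tmul_linearr.
Qed.
Definition tassoc : {linear (U ⊗ V) ⊗ W -> U ⊗ (V ⊗ W)} := tlift tassoc_l tassoc_r.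
Lemma tassocE u v w : tassoc ((u \ot v) \ot w) = u \ot (v \ot w).
Proof. by rewrite tliftE; apply: tmapE. Qed.

Definition tassocV_u (u : U) : {linear V ⊗ W -> (U ⊗ V) ⊗ W} := tmap (tmul u) idfun.
Let tassocV_r u : linear (tassocV_u u). Proof. exact: linearP. Qed.
Let tassocV_l x : linear (tassocV_u^~ x).
Proof.
move=> c u u'.
rewrite -[LHS]/(tassocV_u (c *: u + u') x) -[RHS]/(c *: tassocV_u u x + tassocV_u u' x).
elim/tensor_ind: x => [|x y hx hy|v w].
- by rewrite !linear0 addr0.
- by rewrite !linearD hx hy addrACA.
- by rewrite !tmapE /= tmul_linearl tmul_linearl.
Qed.
Definition tassocV : {linear U ⊗ (V ⊗ W) -> (U ⊗ V) ⊗ W} := tlift tassocV_l tassocV_r.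
Lemma tassocVE u v w : tassocV (u \ot (v \ot w)) = (u \ot v) \ot w.
Proof. by rewrite tliftE; apply: tmapE. Qed.
End Assoc.

Section Unit.
Variable V : lmodType K.
Let scale_l (v : V) : linear (fun c : K^o => c *: v).
Proof. by move=> a b c; rewrite scalerDl scalerA. Qed.
Let scale_r (c : K^o) : linear (fun v : V => c *: v).
Proof. by move=> a v v'; rewrite scalerDr !scalerA mulrC. Qed.

Definition tunitl : {linear K^o ⊗ V -> V} := tlift scale_l scale_r.
Lemma tunitlE c v : tunitl (c \ot v) = c *: v. Proof. exact: tliftE. Qed.
Definition tunitr : {linear V ⊗ K^o -> V} := tlift scale_r scale_l.
Lemma tunitrE v c : tunitr (v \ot c) = c *: v. Proof. exact: tliftE. Qed.
End Unit.

End TensorMaps.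

Notation "f \otm g" := (tmap f g) (at level 40, left associativity) : ring_scope.

Section DirectSum.
Variables (K : fieldType) (M : nat -> lmodType K).

Record dsum := DSum {
  dsum_val :> forall n, M n;
  dsum_fin : exists N, forall n, (N <= n)%N -> dsum_val n = 0 }.

HB.instance Definition _ := gen_eqMixin dsum.
HB.instance Definition _ := gen_choiceMixin dsum.

Lemma dsum_eqP (x y : dsum) : (forall n, x n = y n) -> x = y.
Proof.
case: x => x hx; case: y => y hy /= h.
have E : x = y by apply: functional_extensionality_dep.
by subst y; congr DSum; apply: Prop_irrelevance.
Qed.

Definition dsum0 : dsum.
Proof. by exists (fun=> 0); exists 0. Defined.

Definition dsum_add (x y : dsum) : dsum.
Proof.
exists (fun n => x n + y n).
case: (dsum_fin x) (dsum_fin y) => [N hN] [N' hN'].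
exists (maxn N N') => n; rewrite geq_max => /andP[h h'].
by rewrite hN // hN' // addr0.
Defined.

Definition dsum_opp (x : dsum) : dsum.
Proof.
exists (fun n => - x n); case: (dsum_fin x) => [N hN].
by exists N => n h; rewrite hN // oppr0.
Defined.

Definition dsum_scale (c : K) (x : dsum) : dsum.
Proof.
exists (fun n => c *: x n); case: (dsum_fin x) => [N hN].
by exists N => n h; rewrite hN // scaler0.
Defined.

Let addA : associative dsum_add.
Proof. by move=> x y z; apply: dsum_eqP => n; apply: addrA. Qed.
Let addC : commutative dsum_add.
Proof. by move=> x y; apply: dsum_eqP => n; apply: addrC. Qed.
Let add0 : left_id dsum0 dsum_add.
Proof. by move=> x; apply: dsum_eqP => n; apply: add0r. Qed.
Let addN : left_inverse dsum0 dsum_opp dsum_add.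
Proof. by move=> x; apply: dsum_eqP => n; apply: addNr. Qed.
HB.instance Definition _ := GRing.isZmodule.Build dsum addA addC add0 addN.

Let scaleA a b x : dsum_scale a (dsum_scale b x) = dsum_scale (a * b) x.
Proof. by apply: dsum_eqP => n; apply: scalerA. Qed.
Let scale1 : left_id 1 dsum_scale.
Proof. by move=> x; apply: dsum_eqP => n; apply: scale1r. Qed.
Let scaleDr : right_distributive dsum_scale +%R.
Proof. by move=> c x y; apply: dsum_eqP => n; apply: scalerDr. Qed.
Let scaleDl x : {morph dsum_scale^~ x : a b / a + b}.
Proof. by move=> a b; apply: dsum_eqP => n; apply: scalerDl. Qed.
HB.instance Definition _ :=
  GRing.Zmodule_isLmodule.Build K dsum scaleA scale1 scaleDr scaleDl.

Lemma dsum_addE (x y : dsum) n : (x + y) n = x n + y n. Proof. by []. Qed.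
Lemma dsum_scaleE c (x : dsum) n : (c *: x) n = c *: x n. Proof. by []. Qed.

Definition dproj n (x : dsum) : M n := x n.
Let dproj_linear n : linear (@dproj n). Proof. by []. Qed.
HB.instance Definition _ n :=
  GRing.isLinear.Build K dsum (M n) *:%R (@dproj n) (@dproj_linear n).

Definition dincl n (v : M n) : dsum.
Proof.
exists (fun k => if n =P k is ReflectT e then ecast i (M i) e v else 0).
by exists n.+1 => k hk; case: eqP => // e; rewrite -e ltnn in hk.
Defined.

Lemma dincl_eq n v : @dincl n v n = v.
Proof.
rewrite /dincl /=; case: eqP => // e.
by rewrite (Prop_irrelevance e (erefl n)).
Qed.

Lemma dincl_neq n v k : n != k -> @dincl n v k = 0.
Proof. by rewrite /dincl /=; case: eqP. Qed.

Let dincl_linear n : linear (@dincl n).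
Proof.
move=> c u v; apply: dsum_eqP => k.
have [<-|nk] := eqVneq n k.
  by rewrite dsum_addE dsum_scaleE !dincl_eq.
by rewrite dsum_addE dsum_scaleE !(dincl_neq _ nk) scaler0 addr0.
Qed.
HB.instance Definition _ n :=
  GRing.isLinear.Build K (M n) dsum *:%R (@dincl n) (@dincl_linear n).

Lemma dsum_decomp (x : dsum) N : (forall n, (N <= n)%N -> x n = 0) ->
  x = \sum_(i < N) dincl (x i).
Proof.
move=> hN; apply: dsum_eqP => k.
have -> : dsum_val (\sum_(i < N) dincl (x i)) k = \sum_(i < N) dincl (x i) k.
  exact: (raddf_sum (@dproj k)).
have [kN|Nk] := ltnP k N; last first.
  rewrite hN // big1 // => i _; apply: dincl_neq.
  by rewrite neq_ltn (leq_trans (ltn_ord i) Nk).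
rewrite (bigD1 (Ordinal kN)) // big1.
  by rewrite [RHS]addr0 dincl_eq.
by move=> i /= ne; apply: dincl_neq; apply: contra ne => /eqP e; apply/eqP/val_inj.
Qed.

Section Lift.
Variables (W : lmodType K) (f : forall n, {linear M n -> W}).

Definition dlift_fun (x : dsum) : W :=
  \sum_(i < projT1 (cid (dsum_fin x))) f i (x i).

Lemma dlift_funE (x : dsum) N : (forall n, (N <= n)%N -> x n = 0) ->
  dlift_fun x = \sum_(i < N) f i (x i).
Proof.
rewrite /dlift_fun; case: cid => N' /= hN' hN.
wlog le : N N' hN hN' / (N <= N')%N.
  by move=> H; case/orP: (leq_total N N') => h; [|symmetry]; apply: H.
rewrite -!(big_mkord xpredT (fun i => f i (x i))) (big_cat_nat (n := N)) //=.
rewrite [X in _ + X]big_nat [X in _ + X]big1 ?addr0 // => i /andP[h _].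
by rewrite hN // linear0.
Qed.

Let dlift_linear : linear dlift_fun.
Proof.
move=> c x y.
case: (dsum_fin x) (dsum_fin y) => [N hN] [N' hN'].
have hx n : (maxn N N' <= n)%N -> x n = 0.
  by rewrite geq_max => /andP[h _]; apply: hN.
have hy n : (maxn N N' <= n)%N -> y n = 0.
  by rewrite geq_max => /andP[_ h]; apply: hN'.
rewrite (dlift_funE hx) (dlift_funE hy) (@dlift_funE _ (maxn N N')); last first.
  by move=> n h; rewrite dsum_addE dsum_scaleE hx // hy // scaler0 addr0.
rewrite scaler_sumr -big_split; apply: eq_bigr => i _ /=.
by rewrite -linearP.
Qed.
HB.instance Definition _ :=
  GRing.isLinear.Build K dsum W *:%R dlift_fun dlift_linear.

Definition dlift : {linear dsum -> W} := dlift_fun.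

Lemma dliftE n v : dlift (dincl v) = f n v.
Proof.
rewrite /= (@dlift_funE _ n.+1); last first.
  by move=> k h; apply: dincl_neq; rewrite neq_ltn h.
rewrite (bigD1 ord_max) // big1; first by rewrite [LHS]addr0 dincl_eq.
move=> i /andP[_ ne]; rewrite dincl_neq ?linear0 //.
by apply: contra ne => /eqP e; apply/eqP/val_inj.
Qed.

End Lift.

End DirectSum.

Section DirectSumTensor.
Variables (K : fieldType) (M N : nat -> lmodType K) (W : lmodType K).
Variable f : forall i j, {linear M i ⊗ N j -> W}.

Definition dtlift_row i (u : M i) : {linear dsum N -> W} :=
  dlift (fun j => f i j \o tmul u : {linear N j -> W}).
Definition dtlift_at (y : dsum N) i (u : M i) : W := dtlift_row u y.
Let dtlift_at_linear y i : linear (@dtlift_at y i).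
Proof.
move=> c u v; rewrite /dtlift_at; case: (dsum_fin y) => n hn.
rewrite /dtlift_row /= !(dlift_funE _ hn) scaler_sumr -big_split.
by apply: eq_bigr => j _ /=; rewrite tmul_linearl linearP.
Qed.
HB.instance Definition _ y i :=
  GRing.isLinear.Build K (M i) W *:%R (@dtlift_at y i) (@dtlift_at_linear y i).
Definition dtlift_col (y : dsum N) : {linear dsum M -> W} :=
  dlift (fun i => @dtlift_at y i : {linear M i -> W}).

Let dtlift_l y : linear (dtlift_col y). Proof. exact: linearP. Qed.
Let dtlift_r x : linear (dtlift_col^~ x).
Proof.
move=> c y z; case: (dsum_fin x) => n hn.
rewrite /dtlift_col /= !(dlift_funE _ hn) scaler_sumr -big_split.
by apply: eq_bigr => j _; rewrite /= /dtlift_at linearP.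
Qed.
Definition dtlift : {linear dsum M ⊗ dsum N -> W} := tlift dtlift_l dtlift_r.

Lemma dtliftE i j u v : dtlift (dincl u \ot dincl v) = f i j (u \ot v).
Proof. by rewrite tliftE; apply: (etrans (dliftE _ _)); apply: dliftE. Qed.

End DirectSumTensor.

(* Words in the adjacent transpositions, numbered from 0: the letter i stands
   for the transposition of positions i and i + 1. *)
Section ReducedWords.
Variable n : nat.

Definition adj_perm (i : 'I_n.-1) : 'S_n :=
  tperm (widen_ord (leq_pred n) i)
        (Ordinal (eq_ind _ is_true (ltn_ord i) _ (ltn_predRL i n))).

(* The product s_{i_1} ... s_{i_l} as a composition of functions, i.e. with
   s_{i_l} applied first; products in 'S_n compose the other way round. *)
Definition word_perm (s : seq 'I_n.-1) : 'S_n :=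
  (\prod_(i <- rev s) adj_perm i)%g.

Lemma word_perm_ex (w : 'S_n) : exists s, word_perm s == w.
Proof.
pose P (w : 'S_n) := exists s, word_perm s == w.
have P1 : P 1%g by exists [::]; rewrite /word_perm big_nil.
have PM u v : P u -> P v -> P (u * v)%g.
  move=> [s /eqP hs] [t /eqP ht]; exists (t ++ s).
  by rewrite /word_perm rev_cat big_cat /= -/(word_perm s) hs -/(word_perm t) ht.
have Pt d : forall x y : 'I_n, y = (x + d.+1)%N :> nat -> P (tperm x y).
  elim: d => [|d IH] x y hy.
    have hx : (x < n.-1)%N by rewrite ltn_predRL -addn1 -[X in (X < _)%N]hy.
    exists [:: Ordinal hx]; rewrite /word_perm big_cons big_nil mulg1 /adj_perm.
    by apply/eqP; congr (tperm _ _); apply: val_inj; rewrite //= hy addn1.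
  have hz : (x + d.+1 < n)%N by apply: leq_ltn_trans (ltn_ord y); rewrite hy leq_add2l.
  pose z := Ordinal hz.
  have Pzy : P (tperm z y).
    have hx : (z < n.-1)%N by rewrite ltn_predRL /= -addnS -[X in (X < _)%N]hy.
    exists [:: Ordinal hx]; rewrite /word_perm big_cons big_nil mulg1 /adj_perm.
    by apply/eqP; congr (tperm _ _); apply: val_inj; rewrite //= hy !addnS.
  have -> : tperm x y = ((tperm z y)^-1 * (tperm x z * tperm z y))%g.
    rewrite -/(conjg _ _) tpermJ tpermL tpermD //.
    - by rewrite -(inj_eq val_inj) /= neq_ltn [X in _ || X](_ : _ = true) ?orbT // -addn1 leq_add2l.
    - by rewrite -(inj_eq val_inj) /= hy neq_ltn [X in _ || X](_ : _ = true) ?orbT // -addn1 leq_add2l.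
  by rewrite tpermV; apply: (PM) => //; apply: PM => //; apply: IH.
have Pxy (x y : 'I_n) : P (tperm x y).
  have [xy|yx|/val_inj ->] := ltngtP (val x) (val y); last by rewrite tperm1.
    by apply: (Pt (y - x.+1)%N); rewrite addnS -addSn subnKC.
  by rewrite tpermC; apply: (Pt (x - y.+1)%N); rewrite addnS -addSn subnKC.
have [ts -> _] := prod_tpermP w.
by elim: ts => [|t ts IH]; rewrite ?big_nil // big_cons; apply: PM.
Qed.

Lemma word_size_ex (w : 'S_n) :
  exists l, [exists s : l.-tuple 'I_n.-1, word_perm s == w].
Proof.
have [s hs] := word_perm_ex w.
by exists (size s); apply/existsP; exists (in_tuple s).
Qed.

(* Coxeter length: the size of the shortest words for w. *)
Definition perm_length (w : 'S_n) : nat := ex_minn (word_size_ex w).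

Lemma perm_lengthP (w : 'S_n) :
  exists s : (perm_length w).-tuple 'I_n.-1, word_perm s == w.
Proof. by rewrite /perm_length; case: ex_minnP => l /existsP. Qed.

(* Some reduced expression of w; for a braiding, by Matsumoto's theorem, the
   choice does not affect the endomorphisms T_w below. *)
Definition reduced_word (w : 'S_n) : seq 'I_n.-1 := xchoose (perm_lengthP w).

Lemma reduced_wordP (w : 'S_n) : word_perm (reduced_word w) = w.
Proof. exact/eqP/(xchooseP (perm_lengthP w)). Qed.

Lemma size_reduced_word w (s : seq 'I_n.-1) :
  word_perm s = w -> (size (reduced_word w) <= size s)%N.
Proof.
move=> hs; rewrite size_tuple /perm_length; case: ex_minnP => l _; apply.
by apply/existsP; exists (in_tuple s); apply/eqP.
Qed.

End ReducedWords.

Definition block_swap_fun i j (k : 'I_(i + j)) : 'I_(i + j) :=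
  cast_ord (addnC j i)
    (match split k with inl k' => rshift j k' | inr k' => lshift i k' end).

Lemma block_swap_inj i j : injective (@block_swap_fun i j).
Proof.
move=> k l /cast_ord_inj; rewrite -[k]splitK -[l]splitK !unsplitK.
case: (split k) (split l) => [k'|k'] [l'|l'] //=.
- by move/rshift_inj => ->.
- by move/eqP; rewrite eq_rlshift.
- by move/eqP; rewrite eq_lrshift.
- by move/lshift_inj => ->.
Qed.

(* The permutation chi_{ij}: k |-> j + k on the first i positions and
   i + k |-> k on the last j. *)
Definition block_swap i j : 'S_(i + j) := perm (@block_swap_inj i j).

Section TensorAlgebra.
Variables (K : fieldType) (A : lmodType K).

(* A^{⊗n}, with A^{⊗1} = A ⊗ K identified with A through the unitor. *)
Fixpoint tpow (n : nat) : lmodType K :=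
  if n is n'.+1 then (A ⊗ tpow n' : lmodType K) else (K^o : lmodType K).

Definition to_tpow1 : {linear A -> tpow 1} := @tmull K A K^o 1.
Definition of_tpow1 : {linear tpow 1 -> A} := tunitr A.

Fixpoint tpow_split i j : {linear tpow (i + j) -> tpow i ⊗ tpow j} :=
  match i return {linear tpow (i + j) -> tpow i ⊗ tpow j} with
  | 0 => tmul (1 : K^o)
  | i'.+1 => tassocV A (tpow i') (tpow j) \o (idfun \otm tpow_split i' j)
  end.

Fixpoint tpow_cat i j : {linear tpow i ⊗ tpow j -> tpow (i + j)} :=
  match i return {linear tpow i ⊗ tpow j -> tpow (i + j)} with
  | 0 => tunitl (tpow j)
  | i'.+1 => (idfun \otm tpow_cat i' j) \o tassoc A (tpow i') (tpow j)
  end.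

Definition tpow_cast m n (e : m = n) : {linear tpow m -> tpow n} :=
  match e in _ = k return {linear tpow m -> tpow k} with erefl => idfun end.

(* T(A) *)
Definition talg := dsum tpow.

Definition tone : talg := @dincl K tpow 0 (1 : K^o).

(* a |-> t |-> a ⊗ t from A ⊗ T(A) to T(A), through A ⊗ A^{⊗n} = A^{⊗n+1} *)
Definition tprepend_r (a : A) : {linear talg -> talg} :=
  dlift (fun n => @dincl K tpow n.+1 \o (tmul a : {linear tpow n -> tpow n.+1})
    : {linear tpow n -> talg}).
Lemma tprepend_linearl t : linear (tprepend_r^~ t).
Proof.
move=> c a b; case: (dsum_fin t) => n hn.
rewrite /tprepend_r /= !(dlift_funE _ hn) scaler_sumr -big_split.
by apply: eq_bigr => j _; rewrite /= tmul_linearl linearP.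
Qed.
Let tprepend_linearr a : linear (tprepend_r a). Proof. exact: linearP. Qed.
Definition tprepend : {linear A ⊗ talg -> talg} :=
  tlift tprepend_linearl tprepend_linearr.

Section Braiding.
Variable sigma : {linear A ⊗ A -> A ⊗ A}.

(* sigma ⊗ id_X *)
Definition braid_head (X : lmodType K) :
    {linear A ⊗ (A ⊗ X) -> A ⊗ (A ⊗ X)} :=
  tassoc A A X \o (sigma \otm idfun) \o tassocV A A X.

(* braid_at n i is sigma_{i+1} on A^{⊗n}; it is only meaningful when i.+1 < n. *)
Fixpoint braid_at (n i : nat) : {linear tpow n -> tpow n} :=
  match n, i return {linear tpow n -> tpow n} with
  | n'.+2, 0 => braid_head (tpow n')
  | n'.+1, i'.+1 => idfun \otm braid_at n' i'
  | _, _ => idfun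
  end.

(* T^sigma_w *)
Definition braid_perm n (w : 'S_n) : {linear tpow n -> tpow n} :=
  foldr (fun (i : 'I_n.-1) (f : {linear tpow n -> tpow n}) =>
           braid_at n i \o f : {linear tpow n -> tpow n})
        (idfun : {linear tpow n -> tpow n}) (reduced_word w).

(* beta_{ij}; for i = 0 or j = 0 it is the identity, as beta0n and betan0 show. *)
Definition beta_hom i j : {linear tpow i ⊗ tpow j -> tpow j ⊗ tpow i} :=
  tpow_split j i \o tpow_cast (addnC i j) \o braid_perm (block_swap i j) \o tpow_cat i j.

Definition beta : {linear talg ⊗ talg -> talg ⊗ talg} :=
  dtlift (fun i j => (@dincl K tpow j \otm @dincl K tpow i) \o beta_hom i j
    : {linear tpow i ⊗ tpow j -> talg ⊗ talg}).

(* beta_{i1} with A in place of A^{⊗1} *)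
Definition beta_hom1 i : {linear tpow i ⊗ A -> A ⊗ tpow i} :=
  (of_tpow1 \otm idfun) \o beta_hom i 1 \o (idfun \otm to_tpow1).

(* The restriction of beta to T(A) ⊗ A, which takes its values in A ⊗ T(A). *)
Definition beta1 : {linear talg ⊗ A -> A ⊗ talg} :=
  ((of_tpow1 \o @dproj K tpow 1) \otm idfun) \o beta
    \o (idfun \otm (@dincl K tpow 1 \o to_tpow1)).

Section QuasiShuffle.
Variable m : {linear A ⊗ A -> A}.

(* id_X ⊗ b ⊗ id_Z, reassociated as (x ⊗ y) ⊗ (z ⊗ t) |-> x ⊗ b (y ⊗ z) ⊗ t *)
Definition middle (X Y Y' Z : lmodType K) (b : {linear Y ⊗ A -> A ⊗ Y'}) :
    {linear (X ⊗ Y) ⊗ (A ⊗ Z) -> (X ⊗ A) ⊗ (Y' ⊗ Z)} :=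
  tassocV X A (Y' ⊗ Z)
    \o (idfun \otm (tassoc A Y' Z \o (b \otm idfun) \o tassocV Y A Z))
    \o tassoc X Y (A ⊗ Z).

Fixpoint qshuffle_hom (i j : nat) {struct i} : {linear tpow i ⊗ tpow j -> talg} :=
  match i return {linear tpow i ⊗ tpow j -> talg} with
  | 0 => @dincl K tpow j \o tunitl (tpow j)
  | i'.+1 =>
    (fix qshuffle_homS (j : nat) : {linear tpow i'.+1 ⊗ tpow j -> talg} :=
      match j return {linear tpow i'.+1 ⊗ tpow j -> talg} with
      | 0 => @dincl K tpow i'.+1 \o tunitr (tpow i'.+1)
      | j'.+1 =>
        (tprepend \o (idfun \otm qshuffle_hom i' j'.+1)
           \o tassoc A (tpow i') (tpow j'.+1))
        \+ (tprepend \o (idfun \otm qshuffle_homS j')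
              \o tassoc A (tpow i'.+1) (tpow j')
              \o (beta_hom1 i'.+1 \otm idfun)
              \o tassocV (tpow i'.+1) A (tpow j'))
        \+ (tprepend \o (m \otm qshuffle_hom i' j')
              \o middle A (tpow j') (beta_hom1 i'))
      end) j
  end.

Definition qshuffle : {linear talg ⊗ talg -> talg} := dtlift qshuffle_hom.

End QuasiShuffle.

Definition free_rb_mul (m : {linear A ⊗ A -> A}) (lambda : K) :
    {linear (A ⊗ talg) ⊗ (A ⊗ talg) -> A ⊗ talg} :=
  (m \otm qshuffle (lambda \*: m)) \o middle A talg beta1.

End Braiding.

End TensorAlgebra.

Arguments tpow {K} A n.
Arguments to_tpow1 {K} A.
Arguments of_tpow1 {K} A.
Arguments tpow_split {K} A i j.
Arguments tpow_cat {K} A i j.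
Arguments tpow_cast {K} A {m n} e.
Arguments talg {K} A.
Arguments tone {K} A.

Section Algebras.
Variables (K : fieldType) (A : lmodType K).

(* An algebra, not necessarily unital, is a space with an associative
   multiplication mu : A ⊗ A -> A. *)
Definition associative_mul (mu : {linear A ⊗ A -> A}) : Prop :=
  forall a b c, mu (mu (a \ot b) \ot c) = mu (a \ot mu (b \ot c)).

Definition is_subalgebra (mu : {linear A ⊗ A -> A}) (S : A -> Prop) : Prop :=
  [/\ S 0,
      forall (c : K) x y, S x -> S y -> S (c *: x + y)
    & forall x y, S x -> S y -> S (mu (x \ot y))].

Definition rota_baxter (mu : {linear A ⊗ A -> A}) (w : K)
    (P : {linear A -> A}) : Prop :=
  forall x y, mu (P x \ot P y) =
    P (mu (x \ot P y)) + P (mu (P x \ot y)) + w *: P (mu (x \ot y)).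

(* A is the direct sum of S and S', and P is the projection onto S along S'. *)
Definition is_projection (S S' : A -> Prop) (P : {linear A -> A}) : Prop :=
  [/\ forall x, S (P x), forall x, S' (x - P x),
      forall x, S x -> P x = x & forall x, S' x -> P x = 0].

Definition is_braiding (sigma : {linear A ⊗ A -> A ⊗ A}) : Prop :=
  let sigma1 : A ⊗ (A ⊗ A) -> A ⊗ (A ⊗ A) := braid_head sigma A in
  let sigma2 : A ⊗ (A ⊗ A) -> A ⊗ (A ⊗ A) := idfun \otm sigma in
  bijective sigma /\
  sigma1 \o sigma2 \o sigma1 =1 sigma2 \o sigma1 \o sigma2.

Definition is_braided_algebra (m : {linear A ⊗ A -> A})
    (sigma : {linear A ⊗ A -> A ⊗ A}) : Prop :=
  let sigma1 : A ⊗ (A ⊗ A) -> A ⊗ (A ⊗ A) := braid_head sigma A in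
  let sigma2 : A ⊗ (A ⊗ A) -> A ⊗ (A ⊗ A) := idfun \otm sigma in
  let m_id : A ⊗ (A ⊗ A) -> A ⊗ A := (m \otm idfun) \o tassocV A A A in
  let id_m : A ⊗ (A ⊗ A) -> A ⊗ A := idfun \otm m in
  [/\ associative_mul m, is_braiding sigma,
      id_m \o sigma1 \o sigma2 =1 sigma \o m_id
    & m_id \o sigma2 \o sigma1 =1 sigma \o id_m].

(* The subspaces A ⊗ A^{⊗i} and (+)_{i >= 1} A ⊗ A^{⊗i} of A ⊗ T(A) *)
Definition rb_deg (i : nat) (x : A ⊗ talg A) : Prop :=
  exists y : A ⊗ tpow A i, x = (idfun \otm @dincl K (tpow A) i) y.

Definition rb_pos (x : A ⊗ talg A) : Prop :=
  exists (N : nat) (y : nat -> A ⊗ talg A),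
    (forall i, rb_deg i (y i)) /\ x = \sum_(1 <= i < N) y i.

(* The projection of T(A) onto the sum of the A^{⊗n} with D n *)
Definition tdeg_proj (D : pred nat) : {linear talg A -> talg A} :=
  dlift (fun n => (if D n then @dincl K (tpow A) n : {linear tpow A n -> talg A} else \0)
    : {linear tpow A n -> talg A}).

Definition rb_proj0 : {linear A ⊗ talg A -> A ⊗ talg A} :=
  idfun \otm tdeg_proj (pred1 0%N).
Definition rb_proj_pos : {linear A ⊗ talg A -> A ⊗ talg A} :=
  idfun \otm tdeg_proj (fun n => (0 < n)%N).

End Algebras.

Arguments rb_proj0 {K} A.
Arguments rb_proj_pos {K} A.

Section BetaConventions.
Variables (K : fieldType) (A : lmodType K) (sigma : {linear A ⊗ A -> A ⊗ A}).

Lemma tpow_castS m n (e : m = n) (e' : m.+1 = n.+1) (a : A) (x : tpow A m) :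
  tpow_cast A e' (a \ot x) = a \ot tpow_cast A e x.
Proof. by subst n; rewrite (Prop_irrelevance e' (erefl _)). Qed.

Lemma tpow_splitS i j (a : A) (x : tpow A (i + j)) :
  tpow_split A i.+1 j (a \ot x) =
  tassocV A (tpow A i) (tpow A j) (a \ot tpow_split A i j x).
Proof. exact: (congr1 (tassocV _ _ _) (tmapE _ _ _ _)). Qed.

Lemma tpow_catS i j (a : A) (x : tpow A i) (y : tpow A j) :
  tpow_cat A i.+1 j ((a \ot x) \ot y) = a \ot tpow_cat A i j (x \ot y).
Proof.
exact: (etrans (congr1 (idfun \otm tpow_cat A i j) (tassocE _ _ _)) (tmapE _ _ _ _)).
Qed.

Lemma tpow_splitn0 n (e : n = (n + 0)%N) (x : tpow A n) :
  tpow_split A n 0 (tpow_cast A e x) = x \ot (1 : K^o).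
Proof.
elim: n => [|n IH] in e x *.
  rewrite (Prop_irrelevance e (erefl _)) /=.
  have -> : x = (x : K) *: (1 : K^o) by rewrite /GRing.scale /= mulr1.
  by rewrite linearZ -[X in X \ot _]/(x *: (1 : K^o)) [RHS](linearZ_LR (tmull _)).
have e1 : n = (n + 0)%N by rewrite addn0.
elim/tensor_ind: x => [|x y hx hy|a x].
- by rewrite !linear0 [RHS](linear0 (tmull _)).
- by rewrite !linearD hx hy [RHS](linearD (tmull _)).
by rewrite (tpow_castS e1) tpow_splitS IH tassocVE.
Qed.

Lemma tpow_catn0 n (e : (n + 0)%N = n) (x : tpow A n) (c : K^o) :
  tpow_cast A e (tpow_cat A n 0 (x \ot c)) = c *: x.
Proof.
elim: n => [|n IH] in e x *.
  by rewrite (Prop_irrelevance e (erefl _)) /= tunitlE /GRing.scale /= mulrC.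
have e1 : (n + 0)%N = n by rewrite addn0.
elim/tensor_ind: x => [|x y hx hy|a x].
- by rewrite [X in tpow_cat _ _ _ X](linear0 (tmull _)) !linear0.
- by rewrite [X in tpow_cat _ _ _ X](linearD (tmull _)) !linearD hx hy.
by rewrite tpow_catS (tpow_castS e1) IH linearZ.
Qed.

Lemma braid_perm1 n (x : tpow A n) : braid_perm sigma 1 x = x.
Proof.
rewrite /braid_perm; have := @size_reduced_word n 1 [::].
by rewrite /word_perm big_nil leqn0 => /(_ erefl) /nilP ->.
Qed.

Lemma block_swap0n n : block_swap 0 n = 1%g.
Proof.
apply/permP => k; rewrite permE perm1 /block_swap_fun; apply: val_inj => /=.
by case: splitP => [[]|k' ->].
Qed.

Lemma block_swapn0 n : block_swap n 0 = 1%g.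
Proof.
apply/permP => k; rewrite permE perm1 /block_swap_fun; apply: val_inj => /=.
by case: splitP => [k' ->|[]].
Qed.

Lemma beta0n n (x : tpow A n) : beta_hom sigma 0 n ((1 : K^o) \ot x) = x \ot (1 : K^o).
Proof. by rewrite /= block_swap0n braid_perm1 tunitlE scale1r tpow_splitn0. Qed.

Lemma betan0 n (x : tpow A n) : beta_hom sigma n 0 (x \ot (1 : K^o)) = (1 : K^o) \ot x.
Proof. by rewrite /= block_swapn0 braid_perm1 tpow_catn0 scale1r. Qed.

Lemma braid_headE (X : lmodType K) a b (x : X) :
  braid_head sigma X (a \ot (b \ot x)) = tassoc A A X (sigma (a \ot b) \ot x).
Proof.
have h := tmapE sigma (idfun : {linear X -> X}) (a \ot b) x.
apply: (etrans (congr1 (fun t => tassoc A A X (tmap sigma idfun t)) (tassocVE a b x))).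
exact: (congr1 (tassoc A A X) h).
Qed.

Lemma braid_perm11 (x : tpow A 2) :
  braid_perm sigma (block_swap 1 1) x = braid_head sigma K^o x.
Proof.
have E : block_swap 1 1 = word_perm [:: ord0 : 'I_(1 + 1).-1].
  rewrite /word_perm big_cons big_nil mulg1.
  apply/permP => k; rewrite permE /adj_perm /block_swap_fun; apply: val_inj => /=.
  case: tpermP => [->|->|] /=.
  - by case: splitP => [[[]//]|[[|] //]].
  - by case: splitP => [[[|]//]|[[|] //]].
  - by case: k => [[|[|]] // h] n1 n2; [case: n1|case: n2]; apply: val_inj.
have : (size (reduced_word (block_swap 1 1)) <= 1)%N.
  exact: (size_reduced_word (esym E)).
rewrite /braid_perm; have := reduced_wordP (block_swap 1 1).
case: (reduced_word _) => [|i [|//]] hw _; last by rewrite (ord1 i).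
move: hw => /permP/(_ ord0); rewrite /word_perm big_nil perm1 permE.
move/(congr1 val); rewrite /= /block_swap_fun /=.
by case: splitP => [[[]//]|[[|] //]].
Qed.

Lemma beta11 a b :
  (of_tpow1 A \otm of_tpow1 A)
    (beta_hom sigma 1 1 (to_tpow1 A a \ot to_tpow1 A b)) = sigma (a \ot b).
Proof.
have h : tpow_cat A 1 1 (to_tpow1 A a \ot to_tpow1 A b) =
    a \ot to_tpow1 A b :> tpow A 2.
  apply: (etrans (@tpow_catS 0 1 a (1 : K^o) (to_tpow1 A b))).
  apply: (congr1 (@tmul _ A (tpow A 1) a)).
  exact: (etrans (@tunitlE _ (tpow A 1) 1 (to_tpow1 A b)) (scale1r _)).
have he (y : tpow A (1 + 1)) : tpow_cast A (addnC 1 1) y = y.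
  by rewrite (Prop_irrelevance (addnC 1 1) (erefl _)).
have hb : beta_hom sigma 1 1 (to_tpow1 A a \ot to_tpow1 A b) =
    tpow_split A 1 1 (tassoc A A K^o (sigma (a \ot b) \ot (1 : K^o))).
  exact: (congr1 (tpow_split A 1 1) (etrans (he _) (etrans (braid_perm11 _)
    (etrans (congr1 (braid_head sigma K^o) h) (braid_headE a b (1 : K^o)))))).
rewrite hb.
elim/tensor_ind: (sigma _) => [|x y hx hy|u v].
- by rewrite [X in tassoc _ _ _ X](linear0 (tmull _)) !linear0.
- by rewrite [X in tassoc _ _ _ X](linearD (tmull _)) !linearD hx hy.
have hs : tpow_split A 1 1 (u \ot (v \ot (1 : K^o))) = to_tpow1 A u \ot to_tpow1 A v.
  exact: (etrans (@tpow_splitS 0 1 u (to_tpow1 A v)) (tassocVE _ _ _)).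
have h1 (w : A) : of_tpow1 A (to_tpow1 A w) = w.
  exact: (etrans (tunitrE w (1 : K^o)) (scale1r w)).
by rewrite tassocE hs tmapE !h1.
Qed.

End BetaConventions.

(* Main.v *)
(** Let E be the projection of T(A) onto T^0(A) and P1 = id ⊗ E.  The
    quasi-shuffle of two tensors has a component in degree 0 only if both have
    degree 0, and the braiding preserves tensor degrees, so P1 is multiplicative
    for the product of A ⊗ T(A).  Its image is therefore a subalgebra and its
    kernel an ideal, and the Rota-Baxter identities of weight -1 for P1 and
    P2 = id - P1 follow from P1 (x y) = P1 x * P1 y and idempotence alone. *)
Require Import Defs.
From mathcomp Require Import all_boot all_order all_algebra.
Import GRing.Theory.
Local Open Scope ring_scope.

(** * Extensionality for linear maps on tensor products and direct sums *)

Section TensorFacts.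
Context {K : fieldType}.

Lemma dsum_ext {M : nat -> lmodType K} {W : lmodType K}
    (f g : {linear dsum M -> W}) :
  (forall n (v : M n), f (dincl v) = g (dincl v)) -> f =1 g.
Proof.
move=> h x; case: (dsum_fin x) => N hN.
by rewrite (dsum_decomp hN) !linear_sum; apply: eq_bigr => i _.
Qed.

(** Fixing one tensor factor leaves a linear map on a single direct sum, so [dsum_ext] applies to
    each factor in turn. *)
Lemma dtensor_ext {M N : nat -> lmodType K} {W : lmodType K}
    (f g : {linear dsum M ⊗ dsum N -> W}) :
  (forall i j (u : M i) (v : N j),
     f (dincl u \ot dincl v) = g (dincl u \ot dincl v)) -> f =1 g.
Proof.
move=> h; apply: tensor_ext => x y.
apply: (dsum_ext (f \o tmull y) (g \o tmull y)) => i u.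
exact: (dsum_ext (f \o tmul (dincl u)) (g \o tmul (dincl u)) (h i ^~ u) y).
Qed.

Lemma tensor2_ext {U V U' V' W : lmodType K}
    (f g : {linear (U ⊗ V) ⊗ (U' ⊗ V') -> W}) :
  (forall u v u' v', f ((u \ot v) \ot (u' \ot v')) = g ((u \ot v) \ot (u' \ot v'))) ->
  f =1 g.
Proof.
move=> h; apply: tensor_ext => x y.
apply: (tensor_ext (f := f \o tmull y) (g := g \o tmull y)) => u v.
exact: (tensor_ext (f := f \o tmul (u \ot v)) (g := g \o tmul (u \ot v)) (h u v)).
Qed.

Lemma tmul0l {U V : lmodType K} (v : V) : (0 : U) \ot v = 0.
Proof. exact: (linear0 (tmull v)). Qed.

Lemma tmulDl {U V : lmodType K} (u u' : U) (v : V) :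
  (u + u') \ot v = u \ot v + u' \ot v.
Proof. exact: (linearD (tmull v)). Qed.

Lemma tmulBl {U V : lmodType K} (u u' : U) (v : V) :
  (u - u') \ot v = u \ot v - u' \ot v.
Proof. exact: (linearB (tmull v)). Qed.

Lemma tmap_comp {U V U' V' U'' V'' : lmodType K}
    (f : {linear U' -> U''}) (g : {linear V' -> V''})
    (f' : {linear U -> U'}) (g' : {linear V -> V'}) x :
  (f \otm g) ((f' \otm g') x) = ((f \o f') \otm (g \o g')) x.
Proof.
elim/tensor_ind: x => [|x y hx hy|u v]; first by rewrite !linear0.
  by rewrite !linearD hx hy.
by rewrite !tmapE.
Qed.

Lemma tmap_ext {U V U' V' : lmodType K}
    (f f' : {linear U -> U'}) (g g' : {linear V -> V'}) :
  f =1 f' -> g =1 g' -> f \otm g =1 f' \otm g'.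
Proof. by move=> hf hg; apply: tensor_ext => u v; rewrite !tmapE hf hg. Qed.

Lemma tmap0r {U V U' V' : lmodType K} (f : {linear U -> U'})
    (g : {linear V -> V'}) (x : U ⊗ V) :
  (forall v, g v = 0) -> (f \otm g) x = 0.
Proof.
move=> h; elim/tensor_ind: x => [|x y hx hy|u v]; first exact: linear0.
  by rewrite linearD hx hy addr0.
by rewrite tmapE h; apply: (linear0 (tmul _)).
Qed.

Lemma middleE {A X Y Y' Z : lmodType K} (b : {linear Y ⊗ A -> A ⊗ Y'})
    (x : X) (y : Y) (a : A) (z : Z) :
  middle X Z b ((x \ot y) \ot (a \ot z)) =
  tassocV X A (Y' ⊗ Z) (x \ot tassoc A Y' Z (b (y \ot a) \ot z)).
Proof.
pose F : {linear Y ⊗ (A ⊗ Z) -> A ⊗ (Y' ⊗ Z)} :=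
  tassoc A Y' Z \o (b \otm idfun) \o tassocV Y A Z.
rewrite -[LHS]/(tassocV X A (Y' ⊗ Z)
  ((idfun \otm F) (tassoc X Y (A ⊗ Z) ((x \ot y) \ot (a \ot z))))).
rewrite tassocE tmapE.
rewrite -[F _]/(tassoc A Y' Z ((b \otm idfun) (tassocV Y A Z (y \ot (a \ot z))))).
by rewrite tassocVE tmapE.
Qed.

End TensorFacts.

(** * Rota-Baxter identities from a multiplicative idempotent *)

Section MultiplicativeProjection.
Variables (K : fieldType) (R : lmodType K) (mu : {linear R ⊗ R -> R}).
Variables (P Q : {linear R -> R}).
Hypotheses (PP : forall x, P (P x) = P x)
  (PM : forall x y, P (mu (x \ot y)) = mu (P x \ot P y))
  (QE : forall x, Q x = x - P x).

(** All three terms on the right equal [mu (P x \ot P y)], with coefficients 1, 1 and -1. *)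
Lemma rota_baxter_multiplicative : rota_baxter mu (-1) P.
Proof.
by move=> x y; rewrite !PM !PP scaleN1r addrK.
Qed.

(** The image of [Q] lies in the kernel of [P], a two-sided ideal, so [Q] fixes the products x Q(y)
    and Q(x) y. What remains is Q(x) Q(y) = x Q(y) + Q(x) y - (x y - P(x) P(y)), which is plain
    expansion. *)
Lemma rota_baxter_complement : rota_baxter mu (-1) Q.
Proof.
have mulBl x y z : mu ((x - y) \ot z) = mu (x \ot z) - mu (y \ot z).
  by rewrite tmulBl linearB.
have mulBr x y z : mu (z \ot (x - y)) = mu (z \ot x) - mu (z \ot y).
  by rewrite (linearB (tmul z)) linearB.
have PQ x : P (Q x) = 0 by rewrite QE linearB PP subrr.
have PMl x y : P (mu (Q x \ot y)) = 0 by rewrite PM PQ tmul0l linear0.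
have PMr x y : P (mu (x \ot Q y)) = 0 by rewrite PM PQ (linear0 (tmul _)) linear0.
move=> x y; rewrite (QE (mu (x \ot Q y))) PMr subr0.
rewrite (QE (mu (Q x \ot y))) PMl subr0 scaleN1r (QE (mu (x \ot y))) PM.
rewrite !QE !(mulBl, mulBr) -[RHS]addrA; congr (_ + _).
by rewrite !opprB [RHS]addrC addrA subrK.
Qed.

End MultiplicativeProjection.

(** * Image and kernel of the degree-zero projection *)

Section DegreeProjections.
Variables (K : fieldType) (A : lmodType K).

Lemma tdeg_projE (D : pred nat) n (v : tpow A n) :
  tdeg_proj A D (dincl v) = if D n then dincl v else 0.
Proof. by rewrite /tdeg_proj dliftE; case: (D n). Qed.

Lemma tdeg_proj_in (D : pred nat) n (v : tpow A n) :
  D n -> tdeg_proj A D (dincl v) = dincl v.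
Proof. by rewrite tdeg_projE => ->. Qed.

Lemma tdeg_proj_out (D : pred nat) n (v : tpow A n) :
  ~~ D n -> tdeg_proj A D (dincl v) = 0.
Proof. by rewrite tdeg_projE => /negbTE ->. Qed.

(** This factorization through the degree-0 component supplies the preimage that [rb_deg] asks
    for. *)
Lemma tdeg_proj0E (t : talg A) :
  tdeg_proj A (pred1 0%N) t = @dincl K (tpow A) 0 (dproj 0 t).
Proof.
apply: (dsum_ext (tdeg_proj A (pred1 0%N))
  (@dincl K (tpow A) 0 \o @dproj K (tpow A) 0)) => n v.
rewrite -[RHS]/(@dincl K (tpow A) 0 (dsum_val (dincl v) 0)).
case: n v => [|n] v; first by rewrite dincl_eq tdeg_proj_in.
by rewrite dincl_neq // linear0 tdeg_proj_out.
Qed.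

Lemma tdeg_projC (t : talg A) :
  tdeg_proj A (fun n => (0 < n)%N) t = t - tdeg_proj A (pred1 0%N) t.
Proof.
apply: (dsum_ext (tdeg_proj A (fun n => (0 < n)%N))
  (idfun \- tdeg_proj A (pred1 0%N))) => n v.
rewrite -[RHS]/(dincl v - tdeg_proj A (pred1 0%N) (dincl v)) !tdeg_projE.
by case: n v => [|n] v /=; rewrite ?subrr ?subr0.
Qed.

Lemma rb_proj0K x : rb_proj0 A (rb_proj0 A x) = rb_proj0 A x.
Proof.
rewrite /rb_proj0 tmap_comp; apply: tmap_ext => // t.
rewrite -[LHS]/(tdeg_proj A (pred1 0%N) (tdeg_proj A (pred1 0%N) t)).
by rewrite (tdeg_proj0E t) tdeg_projE.
Qed.

Lemma rb_proj_posE x : rb_proj_pos A x = x - rb_proj0 A x.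
Proof.
elim/tensor_ind: x => [|x y hx hy|a t]; first by rewrite !linear0 addr0.
  by rewrite !linearD hx hy addrACA.
by rewrite !tmapE tdeg_projC (linearB (tmul a)).
Qed.

Lemma rb_deg0P x : rb_deg 0 x <-> rb_proj0 A x = x.
Proof.
split=> [[y ->]|<-].
  rewrite /rb_proj0 tmap_comp; apply: tmap_ext => // u.
  by rewrite -[LHS]/(tdeg_proj A (pred1 0%N) (dincl u)) tdeg_projE.
exists ((idfun \otm @dproj K (tpow A) 0) x).
by rewrite tmap_comp; apply: tmap_ext => // t; rewrite tdeg_proj0E.
Qed.

Lemma rb_proj0_deg i x : rb_deg i.+1 x -> rb_proj0 A x = 0.
Proof.
case=> y ->; rewrite /rb_proj0 tmap_comp; apply: tmap0r => u.
by rewrite -[LHS]/(tdeg_proj A (pred1 0%N) (dincl u)) tdeg_proj_out.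
Qed.

Definition rb_component i (x : A ⊗ talg A) : A ⊗ talg A :=
  (idfun \otm (@dincl K (tpow A) i \o @dproj K (tpow A) i)) x.

(** Quantifying over all larger [M] lets the bounds of two summands be merged into their maximum in
    the induction over [tensor_ind]. *)
Lemma rb_decomp x : exists N, forall M, (N <= M)%N -> x = \sum_(i < M) rb_component i x.
Proof.
elim/tensor_ind: x => [|x y [N hN] [N' hN']|a t].
- by exists 0%N => M _; rewrite big1 // => i _; apply: linear0.
- exists (maxn N N') => M; rewrite geq_max => /andP[hM hM'].
  rewrite {1}(hN _ hM) {1}(hN' _ hM') -big_split; apply: eq_bigr => i _.
  by rewrite /rb_component linearD.
case: (dsum_fin t) => N hN; exists N => M hM.
have ht n : (M <= n)%N -> t n = 0 by move=> h; apply/hN/(leq_trans hM).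
rewrite {1}(dsum_decomp ht) (linear_sum (tmul a)).
by apply: eq_bigr => i _; rewrite /rb_component tmapE.
Qed.

Lemma rb_posP x : rb_pos x <-> rb_proj0 A x = 0.
Proof.
split=> [[N [y [hy ->]]]|h].
  rewrite linear_sum big_nat big1 // => i /andP[i0 _].
  by apply: (rb_proj0_deg i.-1); rewrite prednK.
have [N hN] := rb_decomp x.
(* The bound [N.+1] makes the range nonempty, so the index 0, absent from [rb_pos], can be split
   off; its term is [rb_proj0 A x], zero by [h]. *)
exists N.+1, (fun i => rb_component i x); split=> [i|].
  by exists ((idfun \otm @dproj K (tpow A) i) x); rewrite tmap_comp.
rewrite {1}(hN N.+1 (leqnSn N)) -(big_mkord xpredT (fun i => rb_component i x)).
rewrite big_ltn // [X in X + _](_ : _ = 0) ?add0r // -h.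
by apply: tmap_ext => // t; rewrite tdeg_proj0E.
Qed.

End DegreeProjections.

(** * The quasi-shuffle product in degree zero *)

Section QuasiShuffleDegree.
Variables (K : fieldType) (A : lmodType K).
Variables (sigma : {linear A ⊗ A -> A ⊗ A}) (m : {linear A ⊗ A -> A}).
Local Notation E := (tdeg_proj A (pred1 0%N)).

(** Prepending a letter raises the degree by one, so nothing lands in degree 0. *)
Lemma tdeg_proj0_prepend (x : A ⊗ talg A) :
  E (tprepend A x) = 0.
Proof.
elim/tensor_ind: x => [|x y hx hy|a t]; first by rewrite !linear0.
  by rewrite !linearD hx hy addr0.
rewrite tliftE.
apply: (dsum_ext (E \o tprepend_r a) \0) => n v.
rewrite -[LHS]/(E (tprepend_r a (dincl v))).
rewrite dliftE.
exact: tdeg_proj_out.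
Qed.

Lemma qshuffleE i j (u : tpow A i) (v : tpow A j) :
  qshuffle sigma m (dincl u \ot dincl v) = qshuffle_hom sigma m i j (u \ot v).
Proof. exact: dtliftE. Qed.

(** One unfolding of the nested fixpoint, displaying each summand as a [tprepend]. *)
Lemma qshuffle_homSS i j (z : tpow A i.+1 ⊗ tpow A j.+1) :
  qshuffle_hom sigma m i.+1 j.+1 z =
    tprepend A ((idfun \otm qshuffle_hom sigma m i j.+1)
      (tassoc A (tpow A i) (tpow A j.+1) z))
    + tprepend A ((idfun \otm qshuffle_hom sigma m i.+1 j)
        (tassoc A (tpow A i.+1) (tpow A j)
          ((beta_hom1 sigma i.+1 \otm idfun)
            (tassocV (tpow A i.+1) A (tpow A j) z))))
    + tprepend A ((m \otm qshuffle_hom sigma m i j)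
        (middle A (tpow A j) (beta_hom1 sigma i) z)).
Proof. reflexivity. Qed.

(** On homogeneous arguments: two scalars multiply within degree 0; a scalar times a tensor of
    positive degree keeps that degree; two positive degrees give only prepended terms. *)
Lemma tdeg_proj0_qshuffle (x y : talg A) :
  E (qshuffle sigma m (x \ot y)) = qshuffle sigma m (E x \ot E y).
Proof.
have h : E \o qshuffle sigma m =1 qshuffle sigma m \o (E \otm E); last first.
  by apply: (etrans (h (x \ot y))); rewrite -[LHS]/(qshuffle sigma m _) tmapE.
apply: (dtensor_ext (E \o qshuffle sigma m) (qshuffle sigma m \o (E \otm E))).
move=> i j u v.
rewrite -[LHS]/(E (qshuffle sigma m _)) -[RHS]/(qshuffle sigma m _) tmapE.
rewrite qshuffleE.
case: i j u v => [|i] [|j] u v.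
- by rewrite ![in RHS]tdeg_proj_in // qshuffleE; apply: tdeg_proj_in.
- rewrite [E (dincl v)]tdeg_proj_out // !linear0.
  exact: tdeg_proj_out.
- rewrite [E (dincl u)]tdeg_proj_out // tmul0l linear0.
  exact: tdeg_proj_out.
rewrite [E (dincl u)]tdeg_proj_out // tmul0l linear0.
have E0 (p q r : A ⊗ talg A) : E (tprepend A p + tprepend A q + tprepend A r) = 0.
  by rewrite !linearD !tdeg_proj0_prepend !addr0.
rewrite qshuffle_homSS.
exact: E0.
Qed.

End QuasiShuffleDegree.

(** * Multiplicativity of the projection onto degree zero *)

Section Multiplicativity.
Variables (K : fieldType) (A : lmodType K).
Variables (sigma : {linear A ⊗ A -> A ⊗ A}) (m : {linear A ⊗ A -> A}).
Variable lambda : K.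
Local Notation E := (tdeg_proj A (pred1 0%N)).

(** The braiding sends degrees (i, 1) to (1, i), so the projection onto degree 1 inside [beta1]
    merely undoes an inclusion. *)
Lemma beta1E i (u : tpow A i) b :
  beta1 sigma (dincl u \ot b) =
  (of_tpow1 A \otm @dincl K (tpow A) i) (beta_hom sigma i 1 (u \ot to_tpow1 A b)).
Proof.
rewrite -[LHS]/(((of_tpow1 A \o @dproj K (tpow A) 1) \otm idfun)
  (beta sigma ((idfun \otm (@dincl K (tpow A) 1 \o to_tpow1 A)) (dincl u \ot b)))).
rewrite tmapE.
rewrite (dtliftE (fun i j => (@dincl K (tpow A) j \otm @dincl K (tpow A) i) \o beta_hom sigma i j) u (to_tpow1 A b)).
rewrite -[X in (_ \otm _) X]/((@dincl K (tpow A) 1 \otm @dincl K (tpow A) i) (beta_hom sigma i 1 (u \ot to_tpow1 A b))).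
rewrite tmap_comp; apply: tmap_ext => // x.
by rewrite -[LHS]/(of_tpow1 A (dincl x 1%N)) dincl_eq.
Qed.

(** The T(A) factor keeps its degree i when it crosses [b], as the type of [beta_hom] records. *)
Lemma beta1_tdeg_proj0 (t : talg A) b :
  beta1 sigma (E t \ot b) = rb_proj0 A (beta1 sigma (t \ot b)).
Proof.
apply: (dsum_ext (beta1 sigma \o tmull b \o E)
  (rb_proj0 A \o beta1 sigma \o tmull b)) => i u.
rewrite -[LHS]/(beta1 sigma (E (dincl u) \ot b)).
rewrite -[RHS]/(rb_proj0 A (beta1 sigma (dincl u \ot b))).
rewrite [in RHS]beta1E /rb_proj0 tmap_comp.
case: i u => [|i] u.
  rewrite tdeg_proj_in // beta1E; apply: tmap_ext => // x.
  by rewrite -[RHS]/(E (dincl x)) tdeg_proj_in.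
rewrite tdeg_proj_out // tmul0l linear0; apply: esym; apply: tmap0r => x.
by rewrite -[LHS]/(E (dincl x)) tdeg_proj_out.
Qed.

Definition braided_mul a (v : talg A) (z : A ⊗ talg A) : A ⊗ talg A :=
  (m \otm qshuffle sigma (lambda \*: m))
    (tassocV A A (talg A ⊗ talg A) (a \ot tassoc A (talg A) (talg A) (z \ot v))).

Lemma braided_mulE a v c w :
  braided_mul a v (c \ot w) = m (a \ot c) \ot qshuffle sigma (lambda \*: m) (w \ot v).
Proof. by rewrite /braided_mul tassocE tassocVE tmapE. Qed.

Lemma free_rb_mulE a u b v :
  free_rb_mul sigma m lambda ((a \ot u) \ot (b \ot v)) =
  braided_mul a v (beta1 sigma (u \ot b)).
Proof.
rewrite -[LHS]/((m \otm qshuffle sigma (lambda \*: m))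
  (middle A (talg A) (beta1 sigma) ((a \ot u) \ot (b \ot v)))).
by rewrite middleE.
Qed.

(** Justifies calling the degree-0 part the algebra A itself: the identification of [a] with
    [a \ot tone A] respects products. *)
Lemma free_rb_mul_tone a b :
  free_rb_mul sigma m lambda ((a \ot tone A) \ot (b \ot tone A)) =
  m (a \ot b) \ot tone A.
Proof.
rewrite free_rb_mulE beta1E beta0n tmapE braided_mulE.
rewrite -[of_tpow1 A _]/(tunitr A (b \ot (1 : K^o))) tunitrE scale1r.
rewrite qshuffleE.
rewrite -[qshuffle_hom _ _ _ _ _]/(@dincl K (tpow A) 0 (tunitl (tpow A 0) ((1 : K^o) \ot (1 : K^o)))).
by rewrite tunitlE scale1r.
Qed.

Lemma braided_mul_proj0 a v z :
  rb_proj0 A (braided_mul a v z) =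
  braided_mul a (E v) (rb_proj0 A z).
Proof.
elim/tensor_ind: z => [|x y hx hy|c w].
- by rewrite /braided_mul !(linear0, tmul0l, linear0 (tmul _)).
- rewrite /braided_mul in hx hy *.
  by rewrite !(linearD, tmulDl, linearD (tmul _)) hx hy.
by rewrite braided_mulE !tmapE braided_mulE tdeg_proj0_qshuffle.
Qed.

(** The projection enters [braided_mul] as [E] on the right tail and as [rb_proj0] on the braided
    pair; the latter is then pulled back through the braiding to [E] on the left tail. *)
Lemma free_rb_mul_proj0 (x y : A ⊗ talg A) :
  rb_proj0 A (free_rb_mul sigma m lambda (x \ot y)) =
  free_rb_mul sigma m lambda (rb_proj0 A x \ot rb_proj0 A y).
Proof.
pose P := rb_proj0 A; pose mul := free_rb_mul sigma m lambda.
have h : P \o mul =1 mul \o (P \otm P); last first.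
  by apply: (etrans (h (x \ot y))); rewrite -[LHS]/(mul _) tmapE.
apply: (tensor2_ext (P \o mul) (mul \o (P \otm P))) => a u b v.
rewrite -[LHS]/(P (mul _)) -[RHS]/(mul _) tmapE /P /mul.
by rewrite !tmapE !free_rb_mulE braided_mul_proj0 beta1_tdeg_proj0.
Qed.

End Multiplicativity.

(** * Both projections on the free construction *)

Theorem theorem2p6 (K : fieldType) (charK0 : [pchar K] =i pred0)
    (A : lmodType K) (m : {linear A ⊗ A -> A})
    (sigma : {linear A ⊗ A -> A ⊗ A}) (lambda : K)
    (braidedA : is_braided_algebra m sigma) :
  let mul := free_rb_mul sigma m lambda in
  let R0 := rb_deg (A := A) 0 in
  let Rpos := rb_pos (A := A) in
  let P1 := rb_proj0 A in
  let P2 := rb_proj_pos A in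
  [/\ forall a b : A,
        mul ((a \ot tone A) \ot (b \ot tone A)) = m (a \ot b) \ot tone A,
      is_subalgebra mul R0,
      is_projection R0 Rpos P1,
      forall x, P1 (P1 x) = P1 x
    & rota_baxter mul (-1) P1] /\
  [/\ is_subalgebra mul Rpos,
      is_projection Rpos R0 P2,
      forall x, P2 (P2 x) = P2 x
    & rota_baxter mul (-1) P2].
Proof.
move=> mul R0 Rpos P1 P2.
have P1K x : P1 (P1 x) = P1 x by exact: rb_proj0K.
have P1M x y : P1 (mul (x \ot y)) = mul (P1 x \ot P1 y).
  exact: free_rb_mul_proj0.
have P2E x : P2 x = x - P1 x by exact: rb_proj_posE.
(* The two summands become the fixed space and the kernel of [P1], so every closure claim is an
   equation about [P1]. *)
have R0P x : R0 x <-> P1 x = x by exact: rb_deg0P.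
have RposP x : Rpos x <-> P1 x = 0 by exact: rb_posP.
have P1P2 x : P1 (P2 x) = 0 by rewrite P2E linearB P1K subrr.
split; split.
- exact: free_rb_mul_tone.
- split=> [|c x y /R0P hx /R0P hy|x y /R0P hx /R0P hy]; apply/R0P.
  + exact: linear0.
  + by rewrite linearP hx hy.
  + by rewrite P1M hx hy.
- split=> [x|x|x /R0P //|x /RposP //]; first by apply/R0P; apply: P1K.
  by apply/RposP; rewrite -P2E.
- exact: P1K.
- exact: rota_baxter_multiplicative.
- split=> [|c x y /RposP hx /RposP hy|x y /RposP hx /RposP hy]; apply/RposP.
  + exact: linear0.
  + by rewrite linearP hx hy scaler0 addr0.
  + by rewrite P1M hx hy !linear0.
- split=> [x|x|x /RposP hx|x /R0P hx].
  + by apply/RposP; apply: P1P2.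
  (* Here x - P2(x) rewrites to P1(x); the goal closes by idempotence of [P1]. *)
  + by apply/R0P; rewrite P2E opprB addrC subrK.
  + by rewrite P2E hx subr0.
  + by rewrite P2E hx subrr.
- by move=> x; rewrite [LHS]P2E P1P2 subr0.
- exact: rota_baxter_complement _ _ _ _ _ P1K P1M P2E.
Qed.
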